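(* There is no exotic coBUG with a connected component isomorphic to $K_{1,8}$.
   Context: All graphs are finite, simple, undirected, with nonempty vertex set. For distinct vertices $v,w$ of a connected graph $G$, let $\sigma_{vw}$ be the number of shortest paths between $v$ and $w$, and $\sigma_{vw}(x)$ the number of those containing $x$ as an internal vertex (so $\sigma_{vw}(x)=0$ if $x\in\{v,w\}$). The betweenness of a vertex $x$ is $B_G(x)=\sum_{\{v,w\}\subseteq V(G)}\frac{\sigma_{vw}(x)}{\sigma_{vw}}$, the sum being over unordered pairs of distinct vertices. A betweenness-uniform graph (BUG) is a connected graph $G$ in which all vertices have the same betweenness; this common value is the betweenness of $G$. A low-betweenness BUG is a BUG with betweenness smaller than $1$. Stars are the graphs $K_{1,\ell}$ with $\ell\ge 0$ ($K_{1,0}$ is the single-vertex graph). An exotic BUG is a low-betweenness BUG whose complement is not a disjoint union of stars of the same size (i.e. there is no $\ell\ge0$ such that every connected component of the complement is isomorphic to $K_{1,\ell}$). An exotic coBUG is the complement of an exotic BUG. *)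

(* Defs.v *)
From mathcomp Require Import all_boot all_order all_algebra.

Set Implicit Arguments.
Unset Strict Implicit.
Unset Printing Implicit Defensive.

Import GRing.Theory Num.Theory.

Record sgraph := SGraph {
  vertex :> finType;
  edge : rel vertex;
  edge_sym : symmetric edge;
  edge_irrefl : irreflexive edge;
  vertex_nonempty : 0 < #|vertex|
}.

Arguments edge {s}.

Definition isomorphic (G H : sgraph) : Prop :=
  exists f : G -> H, bijective f /\ forall x y : G, edge (f x) (f y) = edge x y.

Section Complement.
Variable G : sgraph.

Definition compl_edge : rel G := [rel x y | (x != y) && ~~ edge x y].

Lemma compl_edge_sym : symmetric compl_edge.
Proof. by move=> x y; rewrite /compl_edge /= eq_sym edge_sym. Qed.

Lemma compl_edge_irrefl : irreflexive compl_edge.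
Proof. by move=> x; rewrite /compl_edge /= eqxx. Qed.

Definition compl : sgraph :=
  SGraph compl_edge_sym compl_edge_irrefl (vertex_nonempty G).

End Complement.

Definition connected (G : sgraph) : Prop := forall x y : G, connect edge x y.

Section Component.
Variables (G : sgraph) (x : G).

Definition component_vertex : finType := {y : G | connect edge x y}.

Definition component_edge : rel component_vertex :=
  [rel y z | edge (val y) (val z)].

Lemma component_edge_sym : symmetric component_edge.
Proof. by move=> y z; rewrite /component_edge /= edge_sym. Qed.

Lemma component_edge_irrefl : irreflexive component_edge.
Proof. by move=> y; rewrite /component_edge /= edge_irrefl. Qed.

Lemma component_nonempty : 0 < #|component_vertex|.
Proof. by apply/card_gt0P; exists (exist _ x (connect0 edge x)). Qed.

(* The connected component of x, as an induced subgraph; every connected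
   component of G is of this form for some x. *)
Definition component : sgraph :=
  SGraph component_edge_sym component_edge_irrefl component_nonempty.

End Component.

Section Star.
Variable l : nat.

(* K_{1,l}: the centre is None, the l leaves are the Some i. *)
Definition star_edge : rel (option 'I_l) := [rel u v | isSome u != isSome v].

Lemma star_edge_sym : symmetric star_edge.
Proof. by move=> u v; rewrite /star_edge /= eq_sym. Qed.

Lemma star_edge_irrefl : irreflexive star_edge.
Proof. by move=> u; rewrite /star_edge /= eqxx. Qed.

Lemma star_nonempty : 0 < #|{: option 'I_l}|.
Proof. by rewrite card_option. Qed.

Definition star : sgraph :=
  SGraph star_edge_sym star_edge_irrefl star_nonempty.

End Star.

(* The paths with n edges from v to w; the tuple p lists the vertices of the
   path other than its starting point v. *)
Definition paths (G : sgraph) (v w : G) (n : nat) : {set n.-tuple G} :=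
  [set p : n.-tuple G | [&& path edge v p, uniq (v :: p) & last v p == w]].

(* A path has fewer than #|G| edges; the value is #|G| if there is no path
   from v to w, which cannot occur in a connected graph. *)
Definition dist (G : sgraph) (v w : G) : nat :=
  find (fun n => paths v w n != set0) (iota 0 #|G|).

Definition shortest_paths (G : sgraph) (v w : G) : {set (dist v w).-tuple G} :=
  paths v w (dist v w).

Definition sigma (G : sgraph) (v w : G) : nat := #|shortest_paths v w|.

Definition sigma_through (G : sgraph) (v w x : G) : nat :=
  #|[set p in shortest_paths v w | [&& x \in v :: p, x != v & x != w]]|.

(* Each unordered pair {v, w} of distinct vertices is counted once, in the
   order given by the enumeration of the vertices; the summand is symmetric in
   v and w. *)
Definition betweenness (G : sgraph) (x : G) : rat :=
  (\sum_(v : G) \sum_(w : G | (enum_rank v < enum_rank w)%N)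
     (sigma_through v w x)%:R / (sigma v w)%:R)%R.

Definition BUG (G : sgraph) : Prop :=
  connected G /\ forall x y : G, betweenness x = betweenness y.

Definition low_betweenness_BUG (G : sgraph) : Prop :=
  BUG G /\ forall x : G, (betweenness x < 1)%R.

Definition exotic_BUG (G : sgraph) : Prop :=
  low_betweenness_BUG G /\
  ~ (exists l : nat, forall x : compl G, isomorphic (component x) (star l)).

Definition exotic_coBUG (H : sgraph) : Prop :=
  exists G : sgraph, exotic_BUG G /\ isomorphic H (compl G).

(* Main.v *)
(* Let H be the complement of G, n the number of vertices, and for an edge e of
   H let t_e be the number of vertices adjacent in H to an end of e. As G has
   diameter 2, e spreads its contribution 1 evenly over n - t_e vertices of G, so
   uniformity says that T(x), the sum of 1 / (n - t_e) over the edges e near x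
   (x adjacent to an end of e), does not depend on x; a component K_{1,8} makes
   the constant 8 / (n - 9). Betweenness below 1 says that H has fewer than n
   edges.
     Comparing T at a leaf and at the other neighbours of its neighbour shows
   that every component with a leaf is a star, and T forces it to be K_{1,8}.
   Let a + 1 be their number and let R be the set of the other vertices,
   f = |R|, N = n - 9 = 9 a + f. All degrees in R are at least 2, and R spans
   E <= f + a edges. The number k(z) of edges near z in R is at least t_e for
   all e at z. This gives t_e <= 9 (an edge with t_e >= 10 requires a >= 3
   because of the degrees, while 10 / (N + 6) <= T = 8 / N means N <= 24) and
   then k(z) >= 9, so E >= 9 and N <= 48. Summing T over R and using convexity
   of t / (n - t) yields 72 (E - f) >= E N >= 9 (9 a + f), contradicting
   E - f <= a. So R is empty. *)
Require Import Defs.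
From mathcomp Require Import all_boot all_order all_algebra.
From mathcomp Require Import zify ring lra.

Set Implicit Arguments.
Unset Strict Implicit.
Unset Printing Implicit Defensive.

Import Order.TTheory GRing.Theory Num.Theory.

(* With [t = M - s], the function [t / (M - t)] lies above its tangent at the
   point where [s = 9 (M - 9) / 8]. *)
Lemma quotient_tangent (F : realFieldType) (M s : F) : (0 <= M -> 0 < s ->
  64 * M * (M - s) - (M - 81) ^+ 2 <= 81 * (M - 9) ^+ 2 * ((M - s) / s))%R.
Proof.
move=> M0 s0; rewrite mulrA (ler_pdivlMr _ _ s0) -subr_ge0.
have -> : (81 * (M - 9) ^+ 2 * (M - s) -
    (64 * M * (M - s) - (M - 81) ^+ 2) * s = M * (8 * s - 9 * (M - 9)) ^+ 2)%R.
  by ring.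
by rewrite mulr_ge0 ?sqr_ge0.
Qed.

(** * Edges, their neighbourhoods and double counting *)

Section EdgeNeighbourhoods.
Variable H : sgraph.
Implicit Types (x y z u v : H) (p q : H * H).

Definition nbr x : {set H} := [set y | edge x y].

(* Each edge is listed once, oriented by the enumeration of the vertices as in
   [betweenness]. *)
Definition edges : {set H * H} :=
  [set p | edge p.1 p.2 && (enum_rank p.1 < enum_rank p.2)].

Definition enbr p : {set H} := nbr p.1 :|: nbr p.2.

(* When [p] is an edge of the complement of [G], the denominator is the number
   of common neighbours in [G] of the ends of [p]. *)
Definition weight p : rat := (#|~: enbr p|%:R^-1)%R.

Definition near x : {set H * H} := [set p in edges | x \in enbr p].

Definition incident y : {set H * H} :=
  [set p in edges | (p.1 == y) || (p.2 == y)].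

(** Expresses through neighbourhoods alone that [y] is the centre of a component K_{1,8}. *)
Definition star_center y :=
  [/\ #|nbr y| = 8 & forall z, z \in nbr y -> nbr z = [set y]].

Definition orient p := if enum_rank p.1 < enum_rank p.2 then p else (p.2, p.1).

Lemma in_nbrC x y : (x \in nbr y) = (y \in nbr x).
Proof. by rewrite !inE edge_sym. Qed.

Lemma nbr_irrefl x : (x \in nbr x) = false.
Proof. by rewrite inE edge_irrefl. Qed.

Lemma edge_neq x y : edge x y -> x != y.
Proof. by apply: contraTneq => ->; rewrite edge_irrefl. Qed.

Lemma orient_edge x y : edge x y -> orient (x, y) \in edges.
Proof.
move=> exy; rewrite /orient /=; case: ltnP => rxy; rewrite inE /= ?exy //.
rewrite edge_sym exy /= ltn_neqAle rxy andbT.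
by rewrite (inj_eq (@ord_inj _)) (inj_eq enum_rank_inj) eq_sym edge_neq.
Qed.

Lemma orient_eq p q : orient p = orient q -> p = q \/ p = (q.2, q.1).
Proof.
case: p q => [a b] [c d]; rewrite /orient /=.
by case: ifP; case: ifP => _ _ [-> ->]; auto.
Qed.

Lemma enbr_swap x y : enbr (x, y) = enbr (y, x).
Proof. exact: setUC. Qed.

Lemma enbr_orient p : enbr (orient p) = enbr p.
Proof. by rewrite /orient; case: ifP => // _; rewrite /enbr setUC. Qed.

Lemma orient_endpoint p y :
  ((orient p).1 == y) || ((orient p).2 == y) = (p.1 == y) || (p.2 == y).
Proof. by rewrite /orient; case: ifP => // _; rewrite orbC. Qed.

Lemma card_incident y : #|incident y| = #|nbr y|.
Proof.
rewrite -(@card_in_imset _ _ (fun z => orient (y, z)) (nbr y)); last first.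
  by move=> z u _ _ /orient_eq [[]|[-> ->]].
apply/eq_card => -[a b]; rewrite inE /=; apply/idP/imsetP.
  rewrite inE /= => /andP [/andP [eab rab]] /orP [] /eqP E.
    by exists b; rewrite ?inE -E // /orient /= rab.
  exists a; rewrite ?inE -E 1?edge_sym // /orient /=.
  by rewrite ltnNge (ltnW rab).
case=> z; rewrite inE => eyz E.
have := orient_endpoint (y, z) y; rewrite -E /= eqxx => ->.
by rewrite andbT E orient_edge.
Qed.

Lemma near_leaf x y : nbr x = [set y] -> near x = incident y.
Proof.
move=> nx; apply/setP => p.
have E z : edge z x = (z == y) by rewrite edge_sym -(in_set1 z y) -nx inE.
by rewrite !inE !E.
Qed.

(** Incidences are counted from both sides. As [F] is closed under adjacency, an edge with its first
    end in [F] is counted at both ends. *)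
Lemma handshake (F : {set H}) :
  (forall x y, edge x y -> (x \in F) = (y \in F)) ->
  \sum_(x in F) #|nbr x| = 2 * #|[set p in edges | p.1 \in F]|.
Proof.
move=> clF.
under eq_bigr do rewrite -card_incident -sum1dep_card big_mkcondr /=.
rewrite exchange_big /= [RHS]mulnC -sum_nat_const big_mkcond [RHS]big_mkcond /=.
apply: eq_bigr => -[a b] _; rewrite !inE /=.
case: ifP => //= /andP [eab rab]; have nab := edge_neq eab.
rewrite -big_mkcondr /= sum1dep_card.
case: ifP => aF; last first.
  apply: eq_card0 => x; rewrite inE; apply/negP => /andP [xF] /orP [] /eqP E.
    by rewrite E xF in aF.
  by rewrite (clF _ _ eab) E xF in aF.
rewrite (_ : [set _ | _] = [set a; b]) ?cards2 ?nab //.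
apply/setP => x; rewrite !inE ![_ == x]eq_sym andb_idl // => /orP [] /eqP -> //.
by rewrite -(clF _ _ eab).
Qed.

Lemma card_enbr_ge x y : edge x y -> #|nbr x| < #|enbr (x, y)|.
Proof.
move=> exy; rewrite -(addn0 #|nbr x|) -addnS.
rewrite -(_ : #|x |: nbr x| = #|nbr x| + 1); last first.
  by rewrite cardsU1 nbr_irrefl addnC.
apply: subset_leq_card; rewrite subUset subsetUl andbT sub1set !inE /=.
by rewrite (edge_sym y) exy orbT.
Qed.

(* [x] is sent to the edge [zx] if it is adjacent to [z], and otherwise to [yx];
   as [yz] is already used, [z] is sent to an edge [vv'] with [v] adjacent to [z]
   and [v != y], [v' != z]. *)
Lemma card_near_ge z y : edge z y ->
    1 < #|nbr z| -> (forall v, v \in nbr z -> 1 < #|nbr v|) ->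
  #|enbr (z, y)| <= #|near z|.
Proof.
move=> ezy dz dnz.
have other x u : 1 < #|nbr x| -> exists2 v, edge x v & v != u.
  move=> d1; have : 0 < #|nbr x :\ u| by move: d1; rewrite (cardsD1 u); case: (u \in _); lia.
  by case/card_gt0P => v; rewrite !inE => /andP [? ?]; exists v.
have [v ezv vy] := other z y dz.
have [] // := other v z; first by apply: dnz; rewrite inE.
move=> v' evv' v'z.
pose phi x := if edge z x then (z, x) else if x == z then (v, v') else (y, x).
have zy := edge_neq ezy; have zv := edge_neq ezv.
have phiP x : x \in enbr (z, y) ->
  edge (phi x).1 (phi x).2 && (edge (phi x).1 z || edge (phi x).2 z).
  rewrite !inE /phi /=; case: ifP => [ezx|_] /=; first by rewrite ezx (edge_sym x) ezx orbT.
  case: eqP => [_ _|_] /= => [|->]; first by rewrite evv' (edge_sym v) ezv.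
  by rewrite (edge_sym y) ezy.
(* Distinct [x] give distinct edges: only edges [zx] contain [z], and [vv'] is no edge [yx] of the
   last kind, since [v != y] and [v] is adjacent to [z] while [x] is not. *)
rewrite -(@card_in_imset _ _ (orient \o phi) (enbr (z, y))) /=; last first.
  move=> x x' _ _ /orient_eq; rewrite /phi /=.
  have zz := edge_irrefl z; move/eqP: zy => zy; move/eqP: zv => zv.
  move/eqP: vy => vy; move/eqP: v'z => v'z.
  by case ezx: (edge z x); case ezx': (edge z x'); case: (x =P z) => xz;
    case: (x' =P z) => x'z; case=> E; have /= E1 := congr1 fst E;
    have /= E2 := congr1 snd E; congruence.
apply: subset_leq_card; apply/subsetP => _ /imsetP [x /phiP /andP [exx' xz] ->] /=.
rewrite inE enbr_orient; apply/andP; split; last by rewrite !inE.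
by case: (phi x) exx' => a b; apply: orient_edge.
Qed.

(** An edge [p] is near exactly the vertices of [enbr p], and these lie all inside [F] or all
    outside it. *)
Lemma sum_near (g : H * H -> rat) (F : {set H}) :
  (forall x y, edge x y -> (x \in F) = (y \in F)) ->
  (\sum_(x in F) \sum_(p in near x) g p =
   \sum_(p in edges | p.1 \in F) #|enbr p|%:R * g p)%R.
Proof.
move=> clF.
under eq_bigr do under eq_bigl do rewrite inE.
under eq_bigr do rewrite big_mkcondr /=.
rewrite exchange_big /= [RHS]big_mkcondr /=.
apply: eq_bigr => -[a b]; rewrite inE /= => /andP [eab rab].
have Fn x : x \in enbr (a, b) -> (x \in F) = (a \in F).
  rewrite !inE /= => /orP [] /clF <- //.
  by rewrite (clF _ _ eab).
rewrite -big_mkcondr /= sumr_const; case: ifP => aF.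
  rewrite mulr_natl; congr (_ *+ _)%R; apply: eq_card => x; rewrite -!topredE /=.
  by apply: andb_idl => /Fn ->.
rewrite (_ : #|_| = 0) ?mulr0n //; apply: eq_card0 => x; rewrite -!topredE /=.
by apply/negP => /andP [xF /Fn]; rewrite xF aF.
Qed.

(** This is T(x). *)
Definition load x : rat := (\sum_(p in near x) weight p)%R.

End EdgeNeighbourhoods.

(** * Constant load in the presence of a component K_{1,8} *)

Section UniformLoad.
Variables (H : sgraph) (c : H).
Hypothesis c_center : star_center c.
Hypothesis gt9 : 9 < #|H|.
Implicit Types (x y z u v : H) (p q : H * H).

Lemma enbr_center y z : (forall z, z \in nbr y -> nbr z = [set y]) ->
  z \in nbr y -> enbr (y, z) = y |: nbr y.
Proof. by move=> ny zy; rewrite /enbr /= (ny z) // setUC. Qed.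

Lemma card_enbrC p : #|~: enbr p| = #|H| - #|enbr p|.
Proof. by rewrite -(cardsC (enbr p)) addKn. Qed.

(** An edge in the component of [c] has its neighbourhood among the 9 vertices there; any other edge
    is not near [c]. Hence no weight is the inverse of 0. *)
Lemma enbrC_gt0 p : p \in edges H -> 0 < #|~: enbr p|.
Proof.
case: c_center => d8 lc; case: p => a b; rewrite inE /= => /andP [eab _].
have aux u v : edge u v -> u \in c |: nbr c -> 0 < #|~: enbr (u, v)|.
  move=> euv uc.
  suff /subset_leq_card : enbr (u, v) \subset c |: nbr c.
    rewrite cardsU1 nbr_irrefl d8 /= card_enbrC; lia.
  case/setU1P: uc => [E|uc].
    subst u; rewrite enbr_center //; by rewrite inE.
  have E : v = c by apply/set1P; rewrite -(lc u) // inE.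
  by rewrite E enbr_swap enbr_center // E.
case: (boolP (a \in c |: nbr c)) => [|ac]; first exact: aux.
apply/card_gt0P; exists c; rewrite !inE /= negb_or.
move: ac; rewrite !inE negb_or => /andP [ac eca].
rewrite edge_sym eca edge_sym /=; apply/negP => ecb.
have : a \in nbr b by rewrite inE edge_sym.
by rewrite lc ?inE // (negbTE ac).
Qed.

Lemma weight_gt0 p : p \in edges H -> (0 < weight p)%R.
Proof. by move=> pe; rewrite invr_gt0 ltr0n enbrC_gt0. Qed.

Lemma weight_ge p m : p \in edges H -> #|~: enbr p| <= m ->
  (m%:R^-1 <= weight p)%R.
Proof.
move=> /enbrC_gt0 p0 pm; rewrite lef_pV2 ?ler_nat // posrE ltr0n //.
exact: leq_trans pm.
Qed.

Lemma weight_le p m : 0 < m -> m <= #|~: enbr p| ->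
  (weight p <= m%:R^-1)%R.
Proof.
move=> m0 pm; rewrite lef_pV2 ?ler_nat // posrE ltr0n //.
exact: leq_trans pm.
Qed.

Variable beta : rat.
Hypothesis beta_lt1 : (beta < 1)%R.
(** By [betweenness_compl], the sum is the betweenness of [x] in [G] when [H] is the complement of
    [G]. *)
Hypothesis avoid_load :
  forall x : H, (\sum_(p in edges H | x \notin enbr p) weight p = beta)%R.

Lemma load_const x y : load x = load y.
Proof.
have E z : (load z = \sum_(p in edges H) weight p - beta)%R.
  rewrite -(avoid_load z) /load.
  under eq_bigl do rewrite inE.
  by rewrite [X in (_ = X - _)%R](bigID (fun p => z \in enbr p)) /= addrK.
by rewrite !E.
Qed.

(** Each edge gives a total of 1 to the vertices it is not near, and each of the n vertices receives
    [beta]. *)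
Lemma card_edges_lt : #|edges H| < #|H|.
Proof.
have : (\sum_(x : H) \sum_(p in edges H | x \notin enbr p) weight p
          = #|edges H|%:R)%R.
  under eq_bigr do rewrite big_mkcondr /=.
  rewrite exchange_big /= -[RHS]sumr_const; apply: eq_bigr => p pe.
  rewrite -big_mkcond /= sumr_const -[X in X = _]mulr_natl.
  rewrite (_ : #|_| = #|~: enbr p|); last first.
    by apply: eq_card => x; rewrite in_setC -topredE.
  by rewrite mulfV // pnatr_eq0 -lt0n enbrC_gt0.
under eq_bigr do rewrite avoid_load.
rewrite sumr_const => E.
rewrite -(ltr_nat rat) -E -[X in (X < _)%R]mulr_natl -[ltRHS]mulr1 ltr_pM2l // ltr0n.
exact: leq_trans gt9.
Qed.

Lemma load_leaf x y :
  (forall z, z \in nbr y -> nbr z = [set y]) -> x \in nbr y ->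
  (load x = #|nbr y|%:R / (#|H| - #|nbr y|.+1)%:R)%R.
Proof.
move=> ny xy; rewrite /load (near_leaf (ny x xy)).
rewrite -card_incident mulr_natl -sumr_const; apply: eq_bigr => p py.
rewrite /weight card_enbrC card_incident; congr (((_ - _)%N)%:R^-1)%R.
have -> : enbr p = y |: nbr y.
  case: p py => a b; rewrite !inE /= => /andP [/andP [eab _]] /orP [] /eqP E; subst.
    by rewrite enbr_center // inE.
  by rewrite enbr_swap enbr_center // inE edge_sym.
by rewrite cardsU1 nbr_irrefl.
Qed.

Lemma loadE x : (load x = 8%:R / (#|H| - 9)%:R)%R.
Proof.
case: c_center => d8 lc.
have /card_gt0P [l lc'] : 0 < #|nbr c| by rewrite d8.
by rewrite (load_const x l) (load_leaf lc lc') d8.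
Qed.

(** The edges near the leaf [x] are those at [y], and they are near every other neighbour [z] of
    [y]. Equal loads leave no further edge near [z], so [z] is a leaf too. *)
Lemma leaf_star_center x y : nbr x = [set y] -> star_center y.
Proof.
move=> nx; have xy : x \in nbr y by rewrite in_nbrC nx set11.
have ny z : z \in nbr y -> nbr z = [set y].
  move=> zy; have yz : y \in nbr z by rewrite in_nbrC.
  suff sub : near z \subset incident y.
    apply/setP => u; apply/idP/set1P => [uz|-> //].
    have ezu : edge z u by move: uz; rewrite inE.
    have : orient (u, z) \in near z.
      by rewrite inE enbr_orient orient_edge 1?edge_sym // !inE edge_sym ezu.
    move=> /(subsetP sub); rewrite inE orient_endpoint /= => /andP [_].
    by case/orP => /eqP // E; rewrite E nbr_irrefl in zy.
  rewrite -(near_leaf nx).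
  have le : near x \subset near z.
    rewrite (near_leaf nx); apply/subsetP => -[a b].
    rewrite !inE /= => /andP [-> /orP [] /eqP ->] /=.
      by move: zy; rewrite inE => ->.
    by move: zy; rewrite inE => ->; rewrite orbT.
  (* Weights are positive, so an edge near [z] but not near [x] would make the load of [z]
     larger. *)
  apply/subsetP => p pz; apply: contraT => px.
  have := load_const z x; rewrite /load (big_setID (near x)) /=.
  rewrite (setIidPr le) => /eqP.
  rewrite -subr_eq0 addrAC subrr add0r (bigD1 p) ?in_setD ?px ?pz //=.
  rewrite gt_eqF // ltr_wpDr ?weight_gt0 //; last by case/setIdP: pz.
  apply: sumr_ge0 => q /andP [/setDP [/setIdP [qe _] _] _].
  exact/ltW/weight_gt0.
split=> //.
have := load_leaf ny xy; rewrite loadE.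
have eyx : edge y x by move: xy; rewrite inE.
have := enbrC_gt0 (orient_edge eyx).
rewrite enbr_orient card_enbrC enbr_center // cardsU1 nbr_irrefl => d0.
move=> /eqP; rewrite eqr_div ?pnatr_eq0 -?lt0n ?subn_gt0 //; last by move: d0 => /=; lia.
rewrite -!natrM eqr_nat => /eqP.
(* With d the degree of [y], the cross-multiplied equation amounts to (d - 8) (n - 1) = 0. *)
move: d0 gt9 => /=; nia.
Qed.

(** * The vertices outside the K_{1,8} components *)

Definition leaves : {set H} := [set x | #|nbr x| == 1].
Definition centers : {set H} := [set y | [exists x in leaves, x \in nbr y]].
Definition residue : {set H} := ~: (leaves :|: centers).

Lemma nbr_leaf x y : x \in leaves -> y \in nbr x -> nbr x = [set y].
Proof. by rewrite inE => /cards1P [z ->] /set1P ->. Qed.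

Lemma mem_centers x y : x \in leaves -> y \in nbr x -> y \in centers.
Proof. by move=> xL yx; rewrite inE; apply/existsP; exists x; rewrite xL in_nbrC. Qed.

Lemma centersP y : y \in centers -> star_center y.
Proof.
rewrite inE => /existsP [x /andP [xL xy]]; apply: (leaf_star_center (x := x)).
by apply: nbr_leaf => //; rewrite in_nbrC.
Qed.

Lemma centers_nbr y z : y \in centers -> z \in nbr y -> z \in leaves.
Proof. by move=> /centersP [_ ny] /ny E; rewrite inE E cards1. Qed.

Lemma residue_closed x y : edge x y -> (x \in residue) = (y \in residue).
Proof.
have aux u v : edge u v -> u \in leaves :|: centers -> v \in leaves :|: centers.
  move=> euv; have vu : v \in nbr u by rewrite inE.
  case/setUP => uS; apply/setUP; first by right; apply: mem_centers uS vu.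
  by left; apply: centers_nbr uS vu.
move=> exy; rewrite !in_setC; congr (~~ _); apply/idP/idP; apply: aux => //.
by rewrite edge_sym.
Qed.

(** Leaves are excluded by definition; an isolated vertex would have load 0 instead of 8 / (n -
    9). *)
Lemma residue_nbr x : x \in residue -> 1 < #|nbr x|.
Proof.
rewrite !inE negb_or => /andP [d1 _].
suff : #|nbr x| != 0 by case: #|nbr x| d1 => [|[]].
apply/eqP => /cards0_eq nx.
have : load x = 0%R.
  apply: big1 => p; rewrite !inE => /andP [_].
  by rewrite !(edge_sym _ x) -!(in_set (fun y => edge x y)) -/(nbr x) nx !inE.
by move/eqP; rewrite loadE mulf_eq0 invr_eq0 !pnatr_eq0 subn_eq0 leqNgt gt9.
Qed.

Lemma centers_gt0 : 0 < #|centers|.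
Proof.
case: c_center => d8 lc; have /card_gt0P [l lc'] : 0 < #|nbr c| by rewrite d8.
apply/card_gt0P; exists c; apply: (mem_centers (x := l)); last by rewrite in_nbrC.
by rewrite inE lc // cards1.
Qed.

Lemma disjoint_leaves_centers : [disjoint leaves & centers].
Proof.
apply/pred0P => x /=; apply/negP => /andP [].
by rewrite inE => /eqP d1 /centersP [d8 _]; rewrite d8 in d1.
Qed.

(** Adjacent pairs of a centre and a leaf are counted twice: a centre has 8 neighbours, all leaves,
    and a leaf has one neighbour, a centre. *)
Lemma card_leaves : #|leaves| = 8 * #|centers|.
Proof.
have : \sum_(y in centers) #|nbr y| = \sum_(y in centers) 8.
  by apply: eq_bigr => y /centersP [].
rewrite [RHS]sum_nat_const mulnC => <-; rewrite -sum1_card big_mkcond /=.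
under [RHS]eq_bigr do rewrite -sum1_card big_mkcond /=.
rewrite exchange_big; apply: eq_bigr => x _; rewrite -big_mkcondr sum1_card /=.
case: ifPn => xL.
  have [y nx] : exists y, nbr x = [set y] by apply/cards1P; move: xL; rewrite inE.
  rewrite -(cards1 y); apply: eq_card => u; rewrite !inE -topredE /= in_nbrC nx in_set1.
  apply/esym/andb_idl => /eqP ->; apply: mem_centers xL _; by rewrite nx set11.
apply/esym/eq_card0 => y; rewrite -topredE /=; apply/negP => /andP [yC].
by move/(centers_nbr yC); rewrite (negbTE xL).
Qed.

Lemma card_residue : #|H| = 9 * #|centers| + #|residue|.
Proof.
rewrite -(cardsC (leaves :|: centers)) cardsU.
move: disjoint_leaves_centers; rewrite -setI_eq0 => /eqP ->; rewrite cards0.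
rewrite card_leaves /residue; lia.
Qed.

Definition residue_edges : {set H * H} := [set p in edges H | p.1 \in residue].

Lemma mem_residue_edges p :
  (p \in residue_edges) = (p \in edges H) && (p.1 \in residue).
Proof. exact: in_set. Qed.

(** The stars have 9 vertices but only 8 edges each, so each of them leaves room for one more edge
    in the bound [card_edges_lt]. *)
Lemma card_residue_edges : #|residue_edges| < #|centers| + #|residue|.
Proof.
have clS x y : edge x y -> (x \in ~: residue) = (y \in ~: residue).
  by move/residue_closed; rewrite !in_setC => ->.
have hs : 16 * #|centers| = 2 * #|edges H :\: residue_edges|.
  rewrite (_ : _ :\: _ = [set p in edges H | p.1 \in ~: residue]); last first.
    by apply/setP => p; rewrite !inE; case: (edge _ _ && _); rewrite /= ?andbT ?andbF.
  rewrite -(handshake clS) /residue setCK.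
  rewrite (eq_bigl [in [predU leaves & centers]]) => [|x]; last by rewrite !inE.
  rewrite bigU ?disjoint_leaves_centers //=.
  rewrite (eq_bigr (fun _ => 1)) => [|x]; last by rewrite inE => /eqP.
  rewrite [X in _ + X](eq_bigr (fun _ => 8)) => [|x /centersP [] //].
  rewrite !sum_nat_const card_leaves; lia.
have sub : residue_edges \subset edges H.
  by apply/subsetP => p; rewrite inE => /andP [].
move: card_edges_lt (subset_leq_card sub) hs.
rewrite card_residue cardsD (setIidPr sub); lia.
Qed.

Local Notation n := #|H|.

Lemma near_residue z : z \in residue -> near z \subset residue_edges.
Proof.
move=> zR; apply/subsetP => -[u v] /setIdP [pe].
have euv : edge u v by move: pe; rewrite inE => /andP [].
rewrite mem_residue_edges pe in_setU ![_ \in nbr _]inE /= => pz.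
by case/orP: pz => /residue_closed E; rewrite ?E // (residue_closed euv) E.
Qed.

Lemma card_enbr_residue p : p \in residue_edges -> 2 < #|enbr p|.
Proof.
case: p => u v; rewrite mem_residue_edges inE /= => /andP [/andP [euv _] uR].
apply: leq_ltn_trans (card_enbr_ge euv); exact: residue_nbr.
Qed.

(** Edges of the residue have t_e >= 3, so each edge near [z] adds at least 1 / (n - 3) to the load
    8 / (n - 9). *)
Lemma card_near_le z : z \in residue -> #|near z| * (n - 9) <= 8 * (n - 3).
Proof.
move=> zR.
have : (\sum_(p in near z) (n - 3)%:R^-1 <= load z)%R.
  apply: ler_sum => p pz; have := subsetP (near_residue zR) p pz => pR.
  apply: weight_ge; first by move: pR; rewrite mem_residue_edges => /andP [].
  by rewrite card_enbrC leq_sub2l // card_enbr_residue.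
rewrite sumr_const loadE -[X in (X <= _)%R]mulr_natl ler_pdivrMr ?ltr0n ?subn_gt0; last first.
  by apply: ltn_trans gt9.
rewrite mulrAC ler_pdivlMr ?ltr0n ?subn_gt0 // -!natrM ler_nat //.
Qed.

Lemma card_near_residue z y : z \in residue -> y \in nbr z ->
  #|enbr (z, y)| <= #|near z|.
Proof.
move=> zR; rewrite inE => ezy; apply: card_near_ge => //; first exact: residue_nbr.
by move=> v; rewrite inE => ezv; rewrite residue_nbr // -(residue_closed ezv).
Qed.

Lemma card_enbr_le9 z y : z \in residue -> y \in nbr z -> #|enbr (z, y)| <= 9.
Proof.
move=> zR yz; rewrite leqNgt; apply/negP => t10.
have ezy : edge z y by move: yz; rewrite inE.
have yR : y \in residue by rewrite -(residue_closed ezy).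
have := card_near_le zR; have := card_near_residue zR yz.
have := cardsU (nbr z) (nbr y); rewrite -/(enbr (z, y)).
have := handshake residue_closed; rewrite -/residue_edges.
rewrite (big_setD1 z) //= (big_setD1 y) /=; last first.
  by rewrite in_setD1 yR andbT eq_sym edge_neq.
have : \sum_(x in residue :\ z :\ y) 2 <= \sum_(x in residue :\ z :\ y) #|nbr x|.
  by apply: leq_sum => x; rewrite !in_setD1 => /and3P [_ _]; apply: residue_nbr.
rewrite sum_nat_const.
have := cardsD1 z residue; rewrite zR.
have := cardsD1 y (residue :\ z); rewrite in_setD1 yR eq_sym edge_neq //.
(* The degrees of [z] and [y] sum to at least 10 and the others are at least 2, so E >= f + 3; hence
   there are at least 4 centres and n >= 36. But 10 (n - 9) <= 8 (n - 3) means n <= 33. *)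
move: card_residue_edges card_residue centers_gt0 t10; rewrite /=.
nia.
Qed.

(** With at most 8 edges near [z], each of weight at most 1 / (n - 9), and the edge [zy] of weight
    at most 1 / (n - 8), the load would be below 8 / (n - 9). *)
Lemma card_near_ge9 z : z \in residue -> 9 <= #|near z|.
Proof.
move=> zR; rewrite ltnNge; apply/negP => k8.
have /card_gt0P [y yz] : 0 < #|nbr z| by apply: ltnW; apply: residue_nbr.
have ezy : edge z y by move: yz; rewrite inE.
have t8 : #|enbr (z, y)| <= 8 by apply: leq_trans k8; apply: card_near_residue.
have pz : orient (z, y) \in near z.
  by rewrite inE enbr_orient orient_edge //= !inE (edge_sym y) ezy orbT.
have n10 : 0 < n - 9 by rewrite subn_gt0.
have : (load z <= (n - 8)%:R^-1 + \sum_(p in near z :\ orient (z, y)) (n - 9)%:R^-1)%R.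
  rewrite /load (big_setD1 _ pz) /=; apply: lerD.
    apply: weight_le; first by rewrite subn_gt0; apply: ltn_trans gt9.
    by rewrite card_enbrC enbr_orient leq_sub2l.
  apply: ler_sum => p; rewrite in_setD1 => /andP [_ pn].
  apply: weight_le => //; rewrite card_enbrC leq_sub2l //.
  have := subsetP (near_residue zR) p pn; case: p {pn} => u v.
  rewrite mem_residue_edges inE /= => /andP [/andP [euv _] uR].
  by apply: card_enbr_le9; rewrite // inE.
apply/negP; rewrite -ltNge loadE sumr_const.
have := cardsD1 (orient (z, y)) (near z); rewrite pz => cn.
have c7 : #|near z :\ orient (z, y)| <= 7.
  by move: k8; rewrite cn.
apply: (@lt_le_trans _ _ ((n - 9)%:R^-1 + (n - 9)%:R^-1 *+ 7)%R).
  apply: ltr_leD; last by rewrite ler_wpMn2l ?invr_ge0.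
  have n8 : n - 9 < n - 8 by rewrite ltn_sub2l // (ltn_trans _ gt9).
  by rewrite ltf_pV2 ?posrE ?ltr0n ?ltr_nat // (leq_ltn_trans _ n8).
by rewrite -mulrS mulr_natl.
Qed.

Lemma sum_near_residue (g : H * H -> rat) :
  (\sum_(x in residue) \sum_(p in near x) g p =
   \sum_(p in residue_edges) #|enbr p|%:R * g p)%R.
Proof.
rewrite (sum_near _ residue_closed).
by apply: eq_bigl => p; rewrite mem_residue_edges.
Qed.

(** The point of tangency n - t = 9 (n - 9) / 8 is the value obtained if all t_e in the residue
    equal t, their sum is 9 f, and the sum of t_e / (n - t_e) is 8 f / (n - 9). *)
Lemma weight_tangent p : p \in edges H ->
  (64 * n%:R * #|enbr p|%:R - (n%:R - 81) ^+ 2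
   <= 81 * (n%:R - 9) ^+ 2 * (#|enbr p|%:R * weight p))%R.
Proof.
move=> pe; have s0 := enbrC_gt0 pe.
have -> : (#|enbr p|%:R = n%:R - #|~: enbr p|%:R :> rat)%R.
  by rewrite -(cardsC (enbr p)) natrD addrK.
by apply: quotient_tangent; rewrite ?ler0n ?ltr0n.
Qed.

Lemma residue_empty : residue = set0.
Proof.
apply/eqP/set0Pn => -[z zR].
have k9 := card_near_ge9 zR.
have kN := card_near_le zR.
have E9 := leq_trans k9 (subset_leq_card (near_residue zR)).
pose f : rat := (#|residue|%:R)%R; pose M : rat := (n%:R)%R.
pose e : rat := (#|residue_edges|%:R)%R.
have N0 : (0 < M - 9)%R by rewrite subr_gt0 ltr_nat.
have sumt : (9 * f <= \sum_(p in residue_edges) #|enbr p|%:R * 1 :> rat)%R.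
  rewrite -sum_near_residue /f mulr_natr -sumr_const; apply: ler_sum => x xR.
  by rewrite sumr_const ler_nat card_near_ge9.
have sumw : (\sum_(p in residue_edges) #|enbr p|%:R * weight p = f * (8 / (M - 9)))%R.
  rewrite -sum_near_residue /f mulr_natl -sumr_const; apply: eq_bigr => x xR.
  by rewrite -/(load x) loadE natrB // ltnW.
have : (64 * M * (\sum_(p in residue_edges) #|enbr p|%:R * 1) - e * (M - 81) ^+ 2
        <= 81 * (M - 9) ^+ 2 * (\sum_(p in residue_edges) #|enbr p|%:R * weight p))%R.
  have -> : (e * (M - 81) ^+ 2 = \sum_(p in residue_edges) (M - 81) ^+ 2)%R.
    by rewrite sumr_const -[RHS]mulr_natl.
  rewrite mulr_sumr [leRHS]mulr_sumr -sumrB; apply: ler_sum => p.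
  rewrite mem_residue_edges mulr1 => /andP [pe _]; exact: weight_tangent.
rewrite sumw (_ : 81 * _ * _ = 648 * f * (M - 9))%R; last by field; rewrite gt_eqF.
have f0 : (0 <= f)%R by rewrite ler0n.
have M0 : (0 <= M)%R by rewrite ler0n.
(* From 9 (n - 9) <= 8 (n - 3), that is, n <= 57. *)
have ltM : (M < 81)%R by rewrite ltr_nat; nia.
move=> main.
(* With [sumt], [main] becomes 72 f (81 - M) <= e (81 - M)^2. *)
have key : (72 * f <= e * (81 - M))%R.
  have h1 : (64 * M * (9 * f) <= 64 * M * (\sum_(p in residue_edges) #|enbr p|%:R * 1))%R.
    by apply: ler_wpM2l sumt; lra.
  have h2 : (0 < 81 - M)%R by lra.
  rewrite -(ler_pM2r h2); lra.
have {key} : 72 * #|residue| + #|residue_edges| * n <= #|residue_edges| * 81.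
  rewrite -(ler_nat rat) natrD !natrM -/f -/e -/M; lra.
(* With a + 1 centres, 9 (9 a + f) <= E (n - 9) <= 72 (E - f) <= 72 a forces a = f = 0, whence E =
   0, against E >= 9. *)
move: card_residue_edges card_residue centers_gt0; nia.
Qed.

Lemma uniform_load_star x : exists2 y, star_center y & x \in y |: nbr y.
Proof.
have := in_set0 x; rewrite -residue_empty in_setC => /negbFE /setUP [xL|xC].
  have /cards1P [y nx] : #|nbr x| == 1 by move: xL; rewrite inE.
  by exists y; [exact: leaf_star_center nx | rewrite in_setU in_nbrC nx set11 orbT].
by exists x; [exact: centersP | rewrite setU11].
Qed.

End UniformLoad.

(** * Betweenness in terms of the complement *)

Section Betweenness.
Variable G : sgraph.
Implicit Types (x y v w : G).

Lemma dist_eq v w k : k < #|G| -> paths v w k != set0 ->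
  (forall j, j < k -> paths v w j = set0) -> dist v w = k.
Proof.
move=> kG pk pj; apply/eqP; rewrite eqn_leq /dist; apply/andP; split.
  rewrite leqNgt; apply/negP => /(before_find 0).
  by rewrite nth_iota // add0n pk.
rewrite leqNgt; apply/negP => lt.
have hs : has (fun n => paths v w n != set0) (iota 0 #|G|).
  by apply/hasP; exists k; rewrite // mem_iota.
have := nth_find 0 hs; rewrite nth_iota ?add0n; last exact: ltn_trans lt kG.
by rewrite pj // eqxx.
Qed.

Lemma paths0 v w : v != w -> paths v w 0 = set0.
Proof.
move=> vw; apply/setP => p; rewrite !inE tuple0 /=.
exact: negbTE.
Qed.

Lemma paths1 v w : v != w ->
  paths v w 1 = if edge v w then [set [tuple w]] else set0.
Proof.
move=> vw; apply/setP => p; case/tupleP: p => x p; rewrite tuple0 {p}.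
rewrite inE /= andbT inE andbT.
have [->|xw] := eqVneq x w; first by case: ifP => _; rewrite ?set11 ?in_set0 //= vw.
by rewrite !andbF; case: ifP; rewrite inE // -val_eqE /= eqseq_cons (negbTE xw).
Qed.

Lemma paths2 v w : v != w -> paths v w 2 =
  [set [tuple x; w] | x in [set x | edge v x && edge x w]].
Proof.
move=> vw; apply/setP => p; apply/idP/imsetP.
  case/tupleP: p => x p; case/tupleP: p => y p; rewrite tuple0 {p}.
  rewrite inE /= => /and3P [/and3P [vx xy _] _ /eqP E]; subst y.
  by exists x; [rewrite inE vx | apply: val_inj].
case=> x; rewrite inE => /andP [vx xw] ->; rewrite inE /= vx xw eqxx !inE.
by rewrite negb_or vw (edge_neq vx) (edge_neq xw).
Qed.

Lemma card_through v w x k : dist v w = k -> sigma_through v w x =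
  #|[set p in paths v w k | [&& x \in v :: p, x != v & x != w]]|.
Proof. by move=> <-. Qed.

Lemma card_sigma v w k : dist v w = k -> sigma v w = #|paths v w k|.
Proof. by move=> <-. Qed.

Lemma sigma_through_edge v w x : edge v w -> sigma_through v w x = 0.
Proof.
move=> vw; have nvw := edge_neq vw.
have G2 : 1 < #|G| by have := max_card [in [set v; w]]; rewrite cards2 nvw.
rewrite (@card_through _ _ _ 1); last first.
  apply: dist_eq => // [|[|//]]; last by rewrite paths0.
  by rewrite paths1 // vw; apply/set0Pn; exists [tuple w]; rewrite set11.
apply: eq_card0 => p; rewrite paths1 // vw !inE; apply/negP.
case/and4P => /eqP ->; rewrite /= !inE => /orP [] ->; by rewrite // andbF.
Qed.

(** Outside [v] and [w], adjacency in [G] is non-adjacency in the complement; [v] and [w] belong to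
    neither set. *)
Lemma enbrC_compl v w : @edge (compl G) v w ->
  ~: @enbr (compl G) (v, w) = [set x | edge v x && edge x w].
Proof.
rewrite /= => /andP [vw nvw]; apply/setP => x; rewrite !inE /= !negb_or !negb_and !negbK.
rewrite (edge_sym x).
have [E|vx] := eqVneq v x.
  by subst x; rewrite edge_irrefl (edge_sym w) (negbTE nvw) eq_sym (negbTE vw).
have [E|wx] := eqVneq w x.
  by subst x; rewrite edge_irrefl (negbTE nvw).
by [].
Qed.

Lemma sigma_compl v w x : @edge (compl G) v w ->
    0 < #|~: @enbr (compl G) (v, w)| ->
  sigma v w = #|~: @enbr (compl G) (v, w)| /\
  sigma_through v w x = (x \notin @enbr (compl G) (v, w)).
Proof.
move=> evw; rewrite -in_setC enbrC_compl //; case/andP: evw => vw nvw.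
set S := [set x | _]; move=> S0.
have tup_inj : injective (fun x => [tuple x; w]) by move=> a b /(congr1 val) [].
have d2 : dist v w = 2.
  apply: dist_eq => [||[|[|//]]] *.
  (* [dist] searches only lengths below [#|G|], so three distinct vertices are exhibited. *)
  - case/card_gt0P: S0 => y; rewrite inE => /andP [vy yw].
    have := max_card [in w |: [set v; y]].
    rewrite cardsU1 cards2 !inE negb_or (eq_sym w v) vw (eq_sym w).
    by rewrite (edge_neq vy) (edge_neq yw).
  - by rewrite paths2 // -card_gt0 card_imset.
  - by rewrite paths0.
  - by rewrite paths1 // (negbTE nvw).
rewrite (card_sigma d2) (card_through _ d2) paths2 // card_imset //; split=> //.
have [xS|xS] := boolP (x \in S).
  apply/eqP/cards1P; exists [tuple x; w]; apply/setP => p; rewrite in_set1.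
  apply/setIdP/eqP => [[/imsetP [y yS ->]]|->].
    rewrite /= !inE => /and3P [/or3P [] /eqP -> ]; rewrite ?eqxx //.
  split; first by apply: imset_f.
  move: xS; rewrite inE => /andP [vx xw]; rewrite /= !inE eqxx orbT /=.
  by rewrite eq_sym (edge_neq vx) (edge_neq xw).
apply: eq_card0 => p; apply/negP => /setIdP [/imsetP [y yS ->]].
rewrite /= !inE => /and3P [/or3P [] /eqP E]; subst; rewrite ?eqxx //.
by rewrite yS in xS.
Qed.

(** A pair adjacent in [G] has no internal vertices on its shortest path; a pair adjacent in the
    complement has distance 2 and one shortest path through each common neighbour. *)
Lemma betweenness_compl x :
    (forall p, p \in edges (compl G) -> 0 < #|~: enbr p|) ->
  betweenness x =
  (\sum_(p in edges (compl G) | x \notin enbr p) weight p)%R.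
Proof.
move=> pos; rewrite /betweenness pair_big_dep /=.
rewrite big_mkcond [RHS]big_mkcond /=; apply: eq_bigr => -[v w] _ /=.
have [lt|nlt] := boolP (enum_rank v < enum_rank w); last first.
  have /negbTE -> // : ((v, w) : compl G * compl G) \notin edges (compl G).
  by rewrite inE negb_and nlt orbT.
have [evw|nvw] := boolP (@edge (compl G) v w); last first.
  have /negbTE -> : ((v, w) : compl G * compl G) \notin edges (compl G).
    by rewrite inE negb_and nvw.
  move: nvw; rewrite /= negb_and !negbK => /orP [/eqP E|evw].
    by rewrite E ltnn in lt.
  by rewrite sigma_through_edge // mul0r.
have pe : ((v, w) : compl G * compl G) \in edges (compl G) by rewrite inE evw.
have [-> ->] := sigma_compl x evw (pos _ pe).
by rewrite pe; case: (x \notin _); rewrite ?mul0r ?mul1r.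
Qed.

End Betweenness.

(** * Components K_{1,8} and the conclusion *)

Lemma connected_gt9 (G : sgraph) (c : compl G) :
  connected G -> star_center c -> 9 < #|G|.
Proof.
move=> conn [d8 _]; rewrite ltnNge; apply/negP => le9.
have full : c |: nbr c = setT.
  apply/eqP; rewrite eqEcard subsetT cardsT cardsU1 nbr_irrefl d8 //.
have /card_gt0P [l] : 0 < #|nbr c| by rewrite d8.
rewrite inE => /edge_neq cl.
have /connectP [[|y p] /= pth lE] := conn c l; first by rewrite lE eqxx in cl.
case/andP: pth => cy _.
have : (y : compl G) \in c |: nbr c by rewrite full in_setT.
case/setU1P => [E|]; first by rewrite E edge_irrefl in cy.
by rewrite inE => /andP [_ /negP].
Qed.

Lemma component_star (H : sgraph) (x y : H) :
  star_center y -> x \in y |: nbr y -> isomorphic (component x) (star 8).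
Proof.
move=> [d8 ny] xS.
have closedS u v : edge u v -> u \in y |: nbr y -> v \in y |: nbr y.
  move=> euv /setU1P [E|/ny E]; first by rewrite -E in_setU1 [_ \in nbr _]inE euv orbT.
  have : v \in nbr u by rewrite inE.
  by rewrite E => /set1P ->; rewrite setU11.
have symC : connect_sym (@edge H).
  by apply: sym_connect_sym => u v; rewrite edge_sym.
have connS z : connect edge x z = (z \in y |: nbr y).
  apply/idP/idP => [xz|zS].
    have clS : closed (@edge H) (y |: nbr y) by apply: intro_closed.
    by rewrite -(closed_connect clS xz).
  have toy u : u \in y |: nbr y -> connect edge y u.
    by case/setU1P => [-> //|uy]; apply: connect1; rewrite inE in uy.
  by apply: connect_trans (toy _ zS); rewrite symC toy.
(* The default value of [inord] never occurs, since the index of a neighbour of [y] is below 8. *)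
pose f (z : component x) : star 8 :=
  if val z == y then None else Some (inord (index (val z) (enum (nbr y)))).
have mem_nbr (z : component x) : val z != y -> val z \in nbr y.
  by have := valP z; rewrite connS in_setU1 => /orP [->|].
have f_inj : injective f.
  move=> z1 z2; rewrite /f; case: eqVneq => [E1|n1]; case: eqVneq => [E2|n2] //.
    by move=> _; apply: val_inj; rewrite E1.
  have lt (z : component x) : val z != y -> index (val z) (enum (nbr y)) < 8.
    by move=> nz; rewrite -[X in _ < X]d8 cardE index_mem mem_enum mem_nbr.
  case=> /(congr1 val) /=; rewrite !inordK ?lt // => E.
  by apply: val_inj; apply: (index_inj y _ _ E); rewrite mem_enum mem_nbr.
exists f; split.
  apply: inj_card_bij f_inj _.
  rewrite card_option card_ord card_sig.
  rewrite (eq_card (B := [in y |: nbr y])) => [|z]; last by rewrite -connS inE.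
  by rewrite cardsU1 nbr_irrefl d8.
move=> z1 z2.
change ((isSome (f z1) != isSome (f z2)) = edge (val z1) (val z2)); rewrite /f.
have [E1|n1] := eqVneq (val z1) y; have [E2|n2] := eqVneq (val z2) y.
- by rewrite E1 E2 edge_irrefl.
- by have := mem_nbr _ n2; rewrite E1 inE => ->.
- by have := mem_nbr _ n1; rewrite E2 edge_sym inE => ->.
apply/esym/negP => e12; have : val z2 \in nbr (val z1) by rewrite inE.
by rewrite ny ?mem_nbr // in_set1 (negbTE n2).
Qed.

Lemma star_component_center (H : sgraph) (x : H) :
  isomorphic (component x) (star 8) -> exists c : H, star_center c.
Proof.
case=> f [[g fK gK] fE].
have inC (a b : H) : connect edge x a -> edge a b -> connect edge x b.
  by move=> xa ab; apply: connect_trans xa (connect1 ab).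
pose c := g None; exists (val c).
have nbr_c z : z \in nbr (val c) -> exists2 u : component x, val u = z & isSome (f u).
  rewrite inE => cz; pose u : component x := exist _ z (inC _ _ (valP c) cz).
  exists u => //; have : @edge (component x) c u by [].
  by rewrite -fE gK; case: (f u).
split.
  rewrite -[RHS]card_ord -(card_imset (f := fun i : 'I_8 => val (g (Some i)))); last first.
    by move=> i j /val_inj /(can_inj gK) [].
  apply: eq_card => z; apply/idP/imsetP => [/nbr_c [u <-]|[i _ ->]].
    by case E: (f u) => [i|] // _; exists i; rewrite // -E fK.
  rewrite inE; change (@edge (component x) c (g (Some i))).
  by rewrite -fE !gK.
move=> z /nbr_c [u <- fu]; apply/setP => v; rewrite in_set1 inE.
apply/idP/eqP => [uv|->].
  pose v' : component x := exist _ v (inC _ _ (valP u) uv).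
  have : @edge (component x) u v' by [].
  rewrite -fE; case: (f u) fu => // i _; case E: (f v') => [|] // _.
  by rewrite /c -E fK.
change (@edge (component x) u c).
by rewrite -fE gK; case: (f u) fu.
Qed.

Lemma isomorphic_star_center (H K : sgraph) (c : H) :
  isomorphic H K -> star_center c -> exists c' : K, star_center c'.
Proof.
case=> f [fbij fE] [d8 nc]; have finj := bij_inj fbij.
have nf z : nbr (f z) = f @: nbr z.
  case: fbij => g fK gK; apply/setP => u; rewrite inE.
  apply/idP/imsetP => [zu|[v zv ->]]; last by rewrite fE; rewrite inE in zv.
  by exists (g u); rewrite ?gK // inE -fE gK.
exists (f c); split; first by rewrite nf card_imset.
move=> _ /[!nf] /imsetP [z zc ->].
by rewrite nf (nc z zc) imset_set1.
Qed.

Theorem lemma33 :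
  ~ exists H : sgraph,
      exotic_coBUG H /\ exists x : H, isomorphic (component x) (star 8).
Proof.
case=> H [[G [[[[conn unif] low] exotic] isoHG]] [x /star_component_center [c0 c0S]]].
have [c cS] := isomorphic_star_center isoHG c0S.
have gt9 := connected_gt9 conn cS.
have pos := enbrC_gt0 cS gt9.
apply: exotic; exists 8 => z.
have [y yS zy] := uniform_load_star cS gt9 (low c)
  (fun u => etrans (esym (@betweenness_compl G u pos)) (unif u c)) z.
exact: component_star yS zy.
Qed.
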